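(* Let $p$ be a prime, let $\overline{\mathbb F}_p$ be an algebraic closure of the field with $p$ elements, and let $X=\{(x,y)\in \mathbb G_m^2(\overline{\mathbb F}_p) : x+y=1\}$. For $T\ge 1$ let $X_T$ be the set of points $\mathbf x\in X$ whose order $\mathrm{ord}(\mathbf x)$ in the group $\mathbb G_m^2(\overline{\mathbb F}_p)$ is at most $T$. Then $\#X_T\le 16\, T^{3/2}$ for all (real) $T\ge 1$.
   Context: For a field $K$, $\mathbb G_m^n(K)=(K\setminus\{0\})^n$ with coordinate-wise multiplication. The order of a point is its order as an element of this group; every point of $\mathbb G_m^2(\overline{\mathbb F}_p)$ has finite order. *)

(* Defs.v *)
From HB Require Import structures.
From mathcomp Require Import all_boot all_order all_algebra.
From mathcomp Require Import all_classical all_reals all_analysis.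

Set Implicit Arguments.
Unset Strict Implicit.
Unset Printing Implicit Defensive.

Import Order.TTheory GRing.Theory Num.Theory.

Local Open Scope classical_set_scope.
Local Open Scope ring_scope.

Definition is_algebraic_closure (k : fieldType) (K : closedFieldType)
    (iota : {rmorphism k -> K}) : Prop :=
  forall x : K, algebraicOver iota x.

Section MultiplicativeGroup.
Variable K : fieldType.

Record Gm1 : Type := MkGm1 { Gm1_val :> K; Gm1_neq0 : Gm1_val != 0 }.

HB.instance Definition _ := [isSub for Gm1_val].
HB.instance Definition _ := [Choice of Gm1 by <:].

Implicit Types x y z : Gm1.

Definition Gm1_one : Gm1 := MkGm1 (oner_neq0 K).

Definition Gm1_mul x y : Gm1 :=
  MkGm1 (mulf_neq0 (Gm1_neq0 x) (Gm1_neq0 y)).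

Fact Gm1_inv_subproof x : (x : K)^-1 != 0.
Proof. by rewrite invr_eq0 Gm1_neq0. Qed.

Definition Gm1_inv x : Gm1 := MkGm1 (Gm1_inv_subproof x).

Fact Gm1_mulA : associative Gm1_mul.
Proof. by move=> x y z; apply: val_inj; rewrite /= mulrA. Qed.

Fact Gm1_mul1 : left_id Gm1_one Gm1_mul.
Proof. by move=> x; apply: val_inj; rewrite /= mul1r. Qed.

Fact Gm1_mulr1 : right_id Gm1_one Gm1_mul.
Proof. by move=> x; apply: val_inj; rewrite /= mulr1. Qed.

Fact Gm1_mulV : left_inverse Gm1_one Gm1_inv Gm1_mul.
Proof. by move=> x; apply: val_inj; rewrite /= mulVf ?Gm1_neq0. Qed.

Fact Gm1_mulrV : right_inverse Gm1_one Gm1_inv Gm1_mul.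
Proof. by move=> x; apply: val_inj; rewrite /= mulfV ?Gm1_neq0. Qed.

HB.instance Definition _ :=
  isGroup.Build Gm1 Gm1_mulA Gm1_mul1 Gm1_mulr1 Gm1_mulV Gm1_mulrV.

End MultiplicativeGroup.

(* The coordinatewise group structure is the library's one on finite
   functions with values in a group. *)
Definition Gm (n : nat) (K : fieldType) : Type := {ffun 'I_n -> Gm1 K}.

HB.instance Definition _ (n : nat) (K : fieldType) :=
  Group.copy (Gm n K) {ffun 'I_n -> Gm1 K}.

(* A relation rather than a function, so that an element of infinite order
   gets no order at all instead of a junk value. *)
Definition is_order (G : groupType) (g : G) (n : nat) : Prop :=
  [/\ (0 < n)%N, (g ^+ n)%g = 1%g
    & forall m : nat, (0 < m)%N -> (g ^+ m)%g = 1%g -> (n <= m)%N].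

Definition Xline (K : fieldType) : set (Gm 2 K) :=
  [set P : Gm 2 K | (P ord0 : K) + (P ord_max : K) = 1].

Arguments Xline K : clear implicits.

Definition Xline_order_le (K : fieldType) (R : realType) (T : R) :
    set (Gm 2 K) :=
  [set P : Gm 2 K | Xline K P /\ exists2 n : nat, is_order P n & n%:R <= T].

Arguments Xline_order_le K {R} T.

(* Main.v *)
Require Import Defs.
From HB Require Import structures.
From mathcomp Require Import all_boot all_order all_algebra.
From mathcomp Require Import finmap.
From mathcomp Require Import all_classical all_reals all_analysis.
From mathcomp Require Import zify.

Set Implicit Arguments.
Unset Strict Implicit.
Unset Printing Implicit Defensive.

Import Order.TTheory GRing.Theory Num.Theory.

Local Open Scope classical_set_scope.
Local Open Scope ring_scope.

(** If a point (x, 1 - x) has order n <= T, then x and 1 - x are both n-th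
    roots of unity, so the monomials x^i (1 - x)^j take at most n values.
    Put s = floor (sqrt T).  There are (s + 1)^2 > T >= n exponent pairs with
    0 <= i, j <= s, so two of the monomials agree; dividing one by the other
    gives a relation x^i (1 - x)^j = 1 or x^i = (1 - x)^j with
    0 <= i, j <= s and (i, j) <> (0, 0) ([small_multiplicative_relation]).

    Hence x is a root of one of the polynomials X^i (1 - X)^j - 1 and
    X^i - (1 - X)^j.  These do not vanish identically, because X and 1 - X are
    multiplicatively independent: looking at the point 0 or 1 suffices
    ([relation_poly_neq0]).  Together, for a given (i, j), they have degree at
    most 3 s, so the product over all s^2 + 2 s pairs has at most
    3 s (s^2 + 2 s) <= 9 s^3 <= 16 T^(3/2) roots.  A point of the line is
    determined by its first coordinate, so this bounds the number of points. *)

Lemma GmX (n : nat) (K : fieldType) (P : Gm n K) (k : 'I_n) (m : nat) :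
  ((P ^+ m)%g k : K) = (P k : K) ^+ m.
Proof.
elim: m => [|m IHm]; first by rewrite ffunE.
by rewrite expgS exprS ffunE /= IHm.
Qed.

(** The exponent pairs of two distinct monomials with the same value differ by
    a nonzero vector with entries in [-s, s].  According to whether its two
    entries have the same sign or not, it gives the first or the second kind of
    relation, both with natural exponents. *)
Lemma small_multiplicative_relation (K : fieldType) (x y : K) (n s : nat) :
  x != 0 -> y != 0 -> (0 < n)%N -> x ^+ n = 1 -> y ^+ n = 1 ->
  (n < s.+1 ^ 2)%N ->
  exists2 e : 'I_s.+1 * 'I_s.+1, e != (ord0, ord0) &
    (x ^+ e.1 * y ^+ e.2 == 1) || (x ^+ e.1 == y ^+ e.2).
Proof.
move=> x0 y0 n0 xn yn lt_n.
pose h (e : 'I_s.+1 * 'I_s.+1) := x ^+ e.1 * y ^+ e.2.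
have /injectivePn [e [f neq_ef]] : ~~ injectiveb h.
  apply/negP => /injectiveP h_inj.
  (* all values of h are roots of X^n - 1, which has too few of them *)
  have p0 : 'X^n - 1 != 0 :> {poly K}.
    by rewrite -size_poly_gt0 size_XnsubC.
  have /(max_poly_roots p0) : all (root ('X^n - 1)) (map h (enum predT)).
    apply/allP => _ /mapP[e _ ->]; rewrite rootE !hornerE /h exprMn.
    by rewrite -!exprM ![(_ * n)%N]mulnC !exprM xn yn !expr1n mulr1 subrr.
  rewrite map_inj_uniq // enum_uniq size_map -cardE card_prod card_ord.
  by rewrite size_XnsubC // mulnn ltnS leqNgt lt_n => /(_ isT).
wlog le1 : e f neq_ef / (f.1 <= e.1)%N.
  move=> wl; case: (leqP f.1 e.1) => [le1|/ltnW le1]; first exact: wl.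
  by move=> /esym; apply: wl le1; rewrite // eq_sym.
have lt_sub (a b : 'I_s.+1) : (a - b < s.+1)%N.
  exact: leq_ltn_trans (leq_subr _ _) (ltn_ord a).
rewrite /h => eq_h; case: (leqP f.2 e.2) => le2.
  exists (Ordinal (lt_sub e.1 f.1), Ordinal (lt_sub e.2 f.2)).
    apply: contraNneq neq_ef => -[d1 d2].
    by apply/eqP; rewrite [e]surjective_pairing [f]surjective_pairing;
      congr (_, _); apply/val_inj/eqP;
      rewrite eqn_leq ?le1 ?le2 -subn_eq0 ?d1 ?d2.
  apply/orP; left; apply/eqP => /=.
  apply: (mulIf (mulf_neq0 (expf_neq0 f.1 x0) (expf_neq0 f.2 y0))).
  by rewrite mulrACA -!exprD !subnK // mul1r.
exists (Ordinal (lt_sub e.1 f.1), Ordinal (lt_sub f.2 e.2)).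
  by apply: contraTneq le2 => -[_ d2]; rewrite -leqNgt -subn_eq0 d2.
apply/orP; right; apply/eqP => /=.
apply: (mulIf (mulf_neq0 (expf_neq0 f.1 x0) (expf_neq0 e.2 y0))).
rewrite mulrA -exprD subnK // eq_h mulrCA -exprD subnK //.
exact: ltnW.
Qed.

(** One factor for each of the two kinds of relation with exponents (i, j). *)
Definition relation_poly (K : fieldType) (i j : nat) : {poly K} :=
  ('X^i * (1 - 'X) ^+ j - 1) * ('X^i - (1 - 'X) ^+ j).

Lemma relation_polyE (K : fieldType) (i j : nat) (x : K) :
  (relation_poly K i j).[x] =
  (x ^+ i * (1 - x) ^+ j - 1) * (x ^+ i - (1 - x) ^+ j).
Proof. by rewrite /relation_poly !(hornerE, horner_exp). Qed.

(** At 0 both factors take the value -1 if i > 0; if i = 0, they take the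
    values -1 and 1 at 1. *)
Lemma relation_poly_neq0 (K : fieldType) (i j : nat) :
  (0 < i + j)%N -> relation_poly K i j != 0.
Proof.
move=> ij0; pose c : K := (i == 0)%:R.
suff : (relation_poly K i j).[c] != 0.
  by apply: contraNneq => ->; rewrite horner0.
rewrite relation_polyE /c; case: i ij0 {c} => [|i] ij0.
  case: j ij0 => // j _.
  by rewrite subrr !expr0n /= mulr0 sub0r subr0 mulr1 oppr_eq0 oner_eq0.
by rewrite subr0 expr1n expr0n /= mul0r sub0r mulrNN mulr1 oner_eq0.
Qed.

Lemma size_relation_poly (K : fieldType) (i j s : nat) :
  (i <= s)%N -> (j <= s)%N -> (size (relation_poly K i j) <= (3 * s).+1)%N.
Proof.
move=> le_i le_j.
have size_Y : (size ((1 - 'X) ^+ j : {poly K})%R <= j.+1)%N.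
  apply: leq_trans (size_poly_exp_leq _ _) _.
  by rewrite -opprB size_polyN size_XsubC mul1n.
have size_XY : (size ('X^i * (1 - 'X) ^+ j : {poly K})%R <= (2 * s).+1)%N.
  by apply: leq_trans (size_polyMleq _ _) _; rewrite size_polyXn; lia.
have size_l : (size ('X^i * (1 - 'X) ^+ j - 1 : {poly K})%R <= (2 * s).+1)%N.
  apply: leq_trans (size_polyD _ _) _.
  by rewrite size_polyN size_poly1 geq_max size_XY.
have size_r : (size ('X^i - (1 - 'X) ^+ j : {poly K})%R <= s.+1)%N.
  apply: leq_trans (size_polyD _ _) _.
  by rewrite size_polyN size_polyXn geq_max ltnS le_i (leq_trans size_Y).
apply: leq_trans (size_polyMleq _ _) _.
by have := leq_add size_l size_r; lia.
Qed.

(** Finiteness and the bound come from one estimate: a finite subset B of A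
    gives #|B| distinct roots of q.  An infinite A would contain such a B with
    at least size q elements. *)
Lemma card_set_roots (U : choiceType) (K : fieldType) (A : set U) (f : U -> K)
    (q : {poly K}) :
  q != 0 -> {in A &, injective f} -> (forall a, A a -> root q (f a)) ->
  finite_set A /\ (#|` fset_set A| < size q)%N.
Proof.
move=> q0 f_inj f_root.
have bound (B : {fset U}) : [set` B] `<=` A -> (#|` B| < size q)%N.
  move=> BA; rewrite -(size_map f); apply: max_poly_roots => //.
    by apply/allP => _ /mapP[b bB ->]; apply/f_root/BA.
  rewrite map_inj_in_uniq ?fset_uniq // => a b aB bB.
  by apply: f_inj; rewrite inE; apply: BA.
have finA : finite_set A.
  apply: contrapT => /(@infinite_set_fset _ _ (size q)) [B BA].
  by rewrite leqNgt bound.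
by split=> //; apply: bound; rewrite fset_setK.
Qed.

Theorem theorem1p1 (p : nat) (p_prime : prime p)
    (K : closedFieldType) (iota : {rmorphism 'F_p -> K})
    (K_closure : is_algebraic_closure iota)
    (R : realType) (T : R) (T_ge1 : 1 <= T) :
  finite_set (Xline_order_le K T) /\
  (#|` fset_set (Xline_order_le K T)|%fset)%:R <= 16 * T `^ (3 / 2).
Proof.
have T0 : 0 <= T by exact: le_trans ler01 T_ge1.
pose s := Num.truncn (Num.sqrt T).
have /andP[le_s lt_s] := truncn_itv (sqrtr_ge0 T).
pose D := [pred e : 'I_s.+1 * 'I_s.+1 | e != (ord0, ord0)].
pose q := \prod_(e in D) relation_poly K e.1 e.2.
have q0 : q != 0.
  apply/prodf_neq0 => -[i j]; rewrite inE /= => ne0.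
  apply: relation_poly_neq0; rewrite lt0n addn_eq0.
  by apply: contraNN ne0 => /andP[/eqP i0 /eqP j0]; apply/eqP; congr (_, _);
    apply: val_inj.
have cardD : #|D| = (s * s + 2 * s)%N.
  have := cardC1 (ord0 : 'I_s.+1, ord0 : 'I_s.+1).
  by rewrite card_prod card_ord => ->; lia.
have size_q : (size q <= (9 * s ^ 3).+1)%N.
  apply: leq_trans (size_poly_prod_leq _ _) _.
  have : (\sum_(e in D) size (relation_poly K e.1 e.2)
            <= \sum_(e in D) (3 * s).+1)%N.
    by apply: leq_sum => e _; apply: size_relation_poly; rewrite -ltnS.
  rewrite sum_nat_const cardD -ltnS => /(leq_sub2r (s * s + 2 * s)) le_sum.
  apply: leq_trans le_sum _.
  (* 3 s (s^2 + 2 s) <= 9 s^3 because s is zero or at least 1 *)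
  have : (s * s <= s * s * s)%N by case: (s) => // k; rewrite leq_pmulr.
  by rewrite !expnS expn0; lia.
pose f (P : Gm 2 K) := Gm1_val (P ord0).
have f_root P : Xline_order_le K T P -> root q (f P).
  case=> line [n [n0 Pn _] le_n].
  have lt_n : (n < s.+1 ^ 2)%N.
    rewrite -(ltr_nat R) natrX; apply: le_lt_trans le_n _.
    by rewrite -(sqr_sqrtr T0) ltrXn2r // ?sqrtr_ge0 // ltW.
  have coordX k : Gm1_val (P k) ^+ n = 1 by rewrite -GmX Pn ffunE.
  have [e e0 rel] := small_multiplicative_relation (Gm1_neq0 (P ord0))
    (Gm1_neq0 (P ord_max)) n0 (coordX _) (coordX _) lt_n.
  rewrite rootE /q horner_prod; apply/prodf_eq0; exists e => //.
  have y_eq : 1 - f P = Gm1_val (P ord_max) by rewrite -line addrC addKr.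
  by rewrite relation_polyE y_eq mulf_eq0 !subr_eq0.
have f_inj : {in Xline_order_le K T &, injective f}.
  move=> P P'; rewrite !inE => -[line _] [line' _] eq_f.
  have eq_f' : Gm1_val (P ord_max) = Gm1_val (P' ord_max).
    by apply: (addrI (f P)); rewrite {2}eq_f [LHS]line -line'.
  apply/ffunP => k; apply: val_inj.
  by case: (unliftP ord0 k) => [k' ->|-> //]; rewrite ord1;
     have -> : lift ord0 ord0 = ord_max :> 'I_2 by apply: val_inj.
have [finA ltA] := card_set_roots q0 f_inj f_root.
split=> //.
have -> : T `^ (3 / 2) = Num.sqrt T ^+ 3.
  by rewrite mulrC powRrM powR12_sqrt // powR_mulrn // sqrtr_ge0.
apply: (@le_trans _ _ (16 * s%:R ^+ 3)).
  by rewrite -natrX -natrM ler_nat; lia.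
by rewrite ler_pM2l // lerXn2r // nnegrE ?sqrtr_ge0.
Qed.
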